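(* Let $m\ge 1$ be an integer, $c\in\mathbb{C}\setminus\{0\}$, and $n\in\{1,\dots,m\}$. The eigenvalues of the Kovalevskaya matrix $K(\xi^{(n)})$ of the autonomous Riccati hierarchy at the indicial locus $\xi^{(n)}$ are $$\lambda_i=-n+i\quad\text{for } i=0,1,\dots,n-1,$$ and $$\lambda_i=-n+i+1\quad\text{for } i=n,n+1,\dots,m-1 .$$
   Context: The autonomous $m$-th Riccati hierarchy with constant $c\in\mathbb{C}\setminus\{0\}$ is the system $dx_i/dz=f_i^A(x)$, $i=1,\dots,m$, on $\mathbb{C}^m$, where $$f_i^A(x)=x_{i+1}-c\,x_1x_i\quad(1\le i\le m-1),\qquad f_m^A(x)=-c\,x_1x_m .$$ The variables have weights $p_i=i$. For $n\in\{1,\dots,m\}$ the indicial locus $\xi^{(n)}\in\mathbb{C}^m$ is given by $\xi^{(n)}_i=(n)_i/c$ for $1\le i\le n$ and $\xi^{(n)}_i=0$ for $n<i\le m$, where $(n)_i=n(n-1)\cdots(n-i+1)$ is the falling factorial. For $\xi\in\mathbb{C}^m\setminus\{0\}$ an indicial locus, the Kovalevskaya matrix is the $m\times m$ matrix with entries $$K_{ij}(\xi)=\frac{\partial f_i^A}{\partial x_j}(\xi)+p_i\delta_{ij},\qquad p_i=i,$$ where $\delta_{ij}$ is the Kronecker delta. Its eigenvalues are called the Kovalevskaya exponents associated with $\xi$. *)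

(* Defs.v *)
From mathcomp Require Import all_boot all_order all_algebra complex.
From mathcomp Require Import reals topology normedtype derive.

Set Implicit Arguments.
Unset Strict Implicit.
Unset Printing Implicit Defensive.

Import Order.TTheory GRing.Theory Num.Theory.
Import numFieldNormedType.Exports.

Local Open Scope ring_scope.
Local Open Scope complex_scope.

(* The complex numbers are R[i] with R : realType, and the phase space C^m is
   'rV[R[i]]_d.+1 with m = d.+1.  Indices are shifted by one: the coordinate
   x_k (1 <= k <= m) is x 0 i with i : 'I_d.+1 and k = i.+1, so that x_1 is
   x 0 ord0 and x_m is x 0 ord_max. *)

Definition riccati (R : realType) (d : nat) (c : R[i])
    (x : 'rV[R[i]]_d.+1) : 'rV[R[i]]_d.+1 :=
  \row_(i < d.+1)
    (if i == ord_max then - c * x 0 ord0 * x 0 ord_max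
     else x 0 (inord i.+1) - c * x 0 ord0 * x 0 i).

Definition weight (d : nat) (i : 'I_d.+1) : nat := i.+1.

Definition indicial_locus (R : realType) (d : nat) (c : R[i]) (n : nat) :
    'rV[R[i]]_d.+1 :=
  \row_(i < d.+1) (if (i.+1 <= n)%N then (n ^_ i.+1)%:R / c else 0).

(* Complex derivative of the i-th component of f in the j-th variable; R[i]^o
   is R[i] seen as a normed space over itself. *)
Definition partial (R : realType) (d : nat)
    (f : 'rV[R[i]]_d.+1 -> 'rV[R[i]]_d.+1) (i j : 'I_d.+1)
    (x : 'rV[R[i]]_d.+1) : R[i] :=
  'D_(delta_mx 0 j) (fun y : 'rV[R[i]]_d.+1 => f y 0 i : R[i]^o) x.

Definition kovalevskaya (R : realType) (d : nat)
    (f : 'rV[R[i]]_d.+1 -> 'rV[R[i]]_d.+1) (p : 'I_d.+1 -> nat)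
    (xi : 'rV[R[i]]_d.+1) : 'M[R[i]]_d.+1 :=
  \matrix_(i, j) (partial f i j xi + (p i)%:R * (i == j)%:R).

Definition lambda (R : realType) (n i : nat) : R[i] :=
  if (i < n)%N then - n%:R + i%:R else - n%:R + i%:R + 1.

(* Main.v *)
Require Import Defs.
From HB Require Import structures.
From mathcomp Require Import all_boot all_order all_algebra complex.
From mathcomp Require Import reals.
From mathcomp Require Import ring boolp topology normedtype derive.

(** The hierarchy is the projectivization of the linear equation y^(m+1) = 0:
    it is what the substitution x_i = y^(i) / (c y) makes of the equation.  Each
    Kovalevskaya matrix is therefore a quotient of an (m+1)-dimensional linear
    map whose spectrum is visible.

    Put a_i = (n)_i, so that c xi_i = a_i, also for i > n, where the falling
    factorial vanishes.  Differentiating the quadratic field at xi gives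
      K = U - a e,
    where U is upper bidiagonal with diagonal entries i - n and superdiagonal
    entries 1, a is a column, and e is the first coordinate row.  Let L be the
    same bidiagonal matrix with indices running over 0, ..., m; its eigenvalues
    are k - n for 0 <= k <= m.  The vector (1, a) is in the kernel of L, because
    (k - n) (n)_k + (n)_{k+1} = 0 and (n)_{m+1} = 0, and L induces K on the
    quotient by that vector.  Hence
      X * char_poly K = char_poly L = prod_{0 <= k <= m} (X - (k - n)),
    which is [char_poly_bidiag_perturbed].  The factor of index k = n is X;
    cancelling it leaves the m exponents listed by [lambda]: those with k < n,
    then those with k > n, shifted by one place. *)

Set Implicit Arguments.
Unset Strict Implicit.
Unset Printing Implicit Defensive.

Import Order.TTheory GRing.Theory Num.Theory.
Import numFieldNormedType.Exports.

Local Open Scope ring_scope.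

(** Similarity without an inverse: over an integral domain it is enough that the
    determinant of the intertwining matrix can be cancelled. *)
Lemma char_poly_intertwine (A : idomainType) (k : nat) (M N P : 'M[A]_k) :
  M *m P = P *m N -> \det P != 0 -> char_poly M = char_poly N.
Proof.
move=> MP detP; have detPX : \det (map_mx polyC P) != 0.
  by rewrite det_map_mx polyC_eq0.
apply: (mulfI detPX); rewrite mulrC /char_poly -!det_mulmx.
congr (\det _); rewrite /char_poly_mx mulmxBl mulmxBr -!map_mxM MP.
by rewrite mul_scalar_mx mul_mx_scalar.
Qed.

Lemma char_poly_ublock (A : comNzRingType) (k l : nat)
    (M : 'M[A]_k) (C : 'M[A]_(k, l)) (N : 'M[A]_l) :
  char_poly (block_mx M C 0 N) = char_poly M * char_poly N.
Proof.
rewrite /char_poly -(det_ublock _ (- map_mx polyC C)); congr (\det _).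
rewrite /char_poly_mx map_block_mx scalar_mx_block opp_block_mx add_block_mx.
by rewrite map_mx0 oppr0 addr0 add0r.
Qed.

Lemma char_poly_upper_trig (A : comNzRingType) (k : nat) (M : 'M[A]_k) :
  is_trig_mx M^T -> char_poly M = \prod_(i < k) ('X - (M i i)%:P).
Proof.
move=> Mtrig; have -> : char_poly M = char_poly M^T.
  rewrite /char_poly -det_tr; congr (\det _).
  by rewrite /char_poly_mx linearB /= tr_scalar_mx map_trmx.
by rewrite char_poly_trig //; apply: eq_bigr => i _; rewrite mxE.
Qed.

(** Indices are shifted by one: row i : 'I_d.+1 stands for the variable of
    weight i.+1, and the diagonal entry is that weight minus n. *)
Definition bidiag_mx (A : pzRingType) (d n : nat) : 'M[A]_d.+1 :=
  \matrix_(i, j) ((j == i.+1 :> nat)%:R + (i.+1%:R - n%:R) * (i == j)%:R).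

Definition ffact_col (A : pzRingType) (d n : nat) : 'cV[A]_d.+1 :=
  \col_i (n ^_ i.+1)%:R.

(** This is the recurrence (n)_{k+1} = (n - k) (n)_k; in the last row, where there
    is no superdiagonal entry, it closes because (n)_{d+2} = 0 for n <= d+1. *)
Lemma bidiag_ffact (A : comPzRingType) (d n : nat) :
  (n <= d.+1)%N -> bidiag_mx A d n *m ffact_col A d n = 0.
Proof.
move=> le_nd; apply/matrixP => i k; rewrite !mxE.
under eq_bigr => j _ do rewrite !mxE mulrDl.
rewrite big_split /=.
have -> : \sum_(j < d.+1) (j == i.+1 :> nat)%:R * (n ^_ j.+1)%:R
    = (n ^_ i.+2)%:R :> A.
  have [lt_id|le_di] := ltnP i.+1 d.+1.
    rewrite (bigD1 (Ordinal lt_id)) //= eqxx mul1r big1 ?addr0 // => j.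
    by rewrite -val_eqE /= => /negPf->; rewrite mul0r.
  rewrite big1 => [|j _]; last first.
    by rewrite (ltn_eqF (leq_trans (ltn_ord j) le_di)) mul0r.
  by rewrite ffact_small // ltnS (leq_trans le_nd).
rewrite (bigD1 i) //= eqxx mulr1 big1 => [|j]; last first.
  by rewrite eq_sym => /negPf->; rewrite mulr0 mul0r.
rewrite addr0 ffactnSr natrM.
have [le_in|lt_ni] := leqP i.+1 n; first by rewrite natrB //; ring.
by rewrite ffact_small // mul0r mulr0 addr0.
Qed.

(** The quotient argument in matrix form.  The matrix [L] adds a row and a column
    of index 0 to [U]; the columns of [P] are the null vector (1, a) of [L] and the
    last d+1 basis vectors, so in this basis [L] becomes [B], whose lower right
    block is the map induced on the quotient. *)
Lemma char_poly_bidiag_perturbed (F : idomainType) (d n : nat) :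
  (n <= d.+1)%N ->
  'X * char_poly (bidiag_mx F d n - ffact_col F d n *m delta_mx 0 ord0)
  = \prod_(i < d.+2) ('X - (i%:R - n%:R)%:P).
Proof.
move=> le_nd; set U := bidiag_mx _ _ _; set a := ffact_col _ _ _.
set e : 'rV[F]_d.+1 := delta_mx 0 ord0.
have ea : e *m a = n%:R%:M.
  apply/matrixP => i j; rewrite -rowE !mxE (ord1 i) (ord1 j) eqxx mulr1n.
  by rewrite ffactn1.
pose L := block_mx (- n%:R%:M) e 0 U.
pose P : 'M[F]_(1 + d.+1) := block_mx 1%:M 0 a 1%:M.
pose B : 'M[F]_(1 + d.+1) := block_mx 0 e 0 (U - a *m e).
have LP : L *m P = P *m B.
  rewrite !mulmx_block !mulmx1 !mul1mx !mul0mx !mulmx0 !(addr0, add0r) ea.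
  by rewrite addNr bidiag_ffact // addrC subrK.
have detP : \det P != 0 by rewrite det_lblock !det1 mulr1 oner_neq0.
have := char_poly_intertwine LP detP; rewrite !char_poly_ublock.
have -> : char_poly (0 : 'M[F]_1) = 'X.
  by rewrite char_poly_upper_trig ?trmx0 ?mx0_is_trig // big_ord1 mxE subr0.
move<-; rewrite big_ord_recl; congr (_ * _).
  rewrite char_poly_upper_trig; last exact: mx11_is_trig.
  by rewrite big_ord1 !mxE eqxx mulr1n sub0r.
rewrite char_poly_upper_trig.
  by apply: eq_bigr => i _; rewrite mxE eqxx mulr1 (ltn_eqF (ltnSn i)) add0r.
apply/is_trig_mxP => i j lt_ij; rewrite !mxE.
by rewrite (ltn_eqF (leqW lt_ij)) -val_eqE /= (gtn_eqF lt_ij) mulr0 addr0.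
Qed.

(** The indices k of 0, ..., d+1 other than n are enumerated by [lift], which skips
    n exactly as the two cases of [lambda] do. *)
Lemma prod_lambda (R : realType) (d n : nat) : (n <= d.+1)%N ->
  'X * \prod_(i < d.+1) ('X - (lambda R n i)%:P)
  = \prod_(i < d.+2) ('X - (i%:R - n%:R)%:P).
Proof.
move=> le_nd; rewrite (bigD1_ord (Ordinal (le_nd : n < d.+2)%N)) //= subrr subr0.
congr (_ * _); apply: eq_bigr => i _; rewrite /lambda /bump.
by case: ltnP => _ /=; rewrite ?add0n ?natrD; congr ('X - _%:P); ring.
Qed.

(** A coordinate is a continuous linear form, hence its own differential. *)
Lemma is_derive_coord (K : numFieldType) (d : nat) (i : 'I_d.+1)
    (x v : 'rV[K]_d.+1) :
  is_derive x v (fun y : 'rV[K]_d.+1 => y 0 i : K^o) (v 0 i).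
Proof.
pose f (y : 'rV[K]_d.+1) : K^o := y 0 i.
have f_lin : linear f by move=> a y z; rewrite /f !mxE.
pose Lf := GRing.isLinear.Build _ _ _ _ f f_lin.
(* Bundled by hand so that the lemmas on differentials of linear maps apply. *)
pose g : {linear 'rV[K]_d.+1 -> K^o} := HB.pack f Lf.
have g_cont : continuous g by move=> y; exact: coord_continuous.
have g_diff : differentiable g x by exact: linear_differentiable.
split; first exact: (@diff_derivable _ _ _ g).
rewrite [LHS](@deriveE _ _ _ g _ v g_diff).
by rewrite diff_lin.
Qed.

(** The truncation at the last index is absorbed by the first term: no column j
    satisfies j = d+1, so one formula covers all rows. *)
Lemma partial_riccati (R : realType) (d : nat) (c : complex R)
    (i j : 'I_d.+1) (x : 'rV[complex R]_d.+1) :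
  partial (riccati c) i j x = (j == i.+1 :> nat)%:R
    - c * x 0 ord0 * (i == j)%:R - c * x 0 i * (j == ord0)%:R.
Proof.
set v : 'rV[complex R]_d.+1 := delta_mx 0 j.
pose q (y : 'rV[complex R]_d.+1) : (complex R)^o := c * y 0 ord0 * y 0 i.
have dq : is_derive x v q (c * x 0 ord0 * v 0 i + c * x 0 i * v 0 ord0).
  have := is_deriveM (is_derive_coord ord0 x v) (is_derive_coord i x v).
  move=> /(is_deriveZ c); congr (is_derive x v _ _).
    by apply/funext => y; rewrite /q -mulrA.
  by rewrite scalerDr !scalerA.
have vE k : v 0 k = (j == k)%:R by rewrite mxE eqxx eq_sym.
rewrite !vE in dq; rewrite /partial (eq_sym i).
pose f y : (complex R)^o := riccati c y 0 i.
have [i_max|i_lt] := eqVneq i ord_max.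
  rewrite i_max (ltn_eqF (ltn_ord j)) sub0r -i_max -opprD.
  apply: (@derive_val _ _ _ _ _ f); move: (is_deriveN dq); congr (is_derive x v _ _).
  by apply/funext => y; rewrite /f /riccati mxE i_max eqxx !mulNr -i_max.
have lt_id : (i.+1 < d.+1)%N by rewrite ltnS ltn_neqAle i_lt -ltnS ltn_ord.
apply: (@derive_val _ _ _ _ _ f).
move: (is_deriveB (is_derive_coord (inord i.+1) x v) dq).
congr (is_derive x v _ _); last first.
  by rewrite vE -val_eqE /= inordK // opprD addrA.
by apply/funext => y; rewrite /f /riccati mxE (negPf i_lt).
Qed.

Lemma kovalevskaya_riccatiE (R : realType) (d : nat) (c : complex R) (n : nat) :
  c != 0 -> (1 <= n <= d.+1)%N ->
  kovalevskaya (riccati c) (@weight d) (indicial_locus d c n)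
  = bidiag_mx _ d n - ffact_col _ d n *m delta_mx 0 ord0.
Proof.
move=> c0 /andP[n_gt0 le_nd]; apply/matrixP => i j.
rewrite mxE partial_riccati !mxE big_ord1 !mxE eqxx n_gt0 ffactn1 /weight /=.
have -> : c * (if (i < n)%N then (n ^_ i.+1)%:R / c else 0) = (n ^_ i.+1)%:R.
  case: ltnP => [_|lt_ni]; first by rewrite mulrC divfK.
  by rewrite mulr0 ffact_small.
by rewrite (mulrC c) divfK //; ring.
Qed.

Theorem theorem3p2 (R : realType) (d : nat) (c : complex R) (n : nat)
    (hc : c <> 0%R) (hn : (1 <= n <= d.+1)%N) :
  let K := kovalevskaya (riccati c) (@weight d) (indicial_locus d c n) in
  (forall a : complex R,
     eigenvalue K a <->
     exists i : 'I_d.+1, a = lambda R n i)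
  /\ char_poly K
     = (\prod_(i < d.+1) ('X - (lambda R n i)%:P))%R.
Proof.
move=> K; have /andP[_ le_nd] := hn.
have charK : char_poly K = \prod_(i < d.+1) ('X - (lambda R n i)%:P).
  apply: (mulfI (negbT (polyX_eq0 _))); rewrite prod_lambda //.
  rewrite /K kovalevskaya_riccatiE //; last exact/eqP.
  exact: char_poly_bidiag_perturbed.
split=> // a; rewrite eigenvalue_root_char charK rootE horner_prod; split.
  case/prodf_eq0=> i _; rewrite hornerXsubC subr_eq0 => /eqP->.
  by exists i.
case=> i ->; apply/prodf_eq0; exists i => //.
by rewrite hornerXsubC subrr.
Qed.
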